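(* For every integer $n\ge 2$, \[\mathcal{I}_n(n)=3\,\mathcal{I}_{n-1}(n-1)+3^{n-1}-2\,\mathcal{D}_{n-1}(n-1,n-1).\]
   Context: For positive integers $m,n$, let $T_{m,n}$ be the table with $m$ rows and $n$ columns; cell $(x,y)$ is in column $x$ and row $y$ (rows numbered from the bottom). Allowed steps are $(1,0),(1,1),(1,-1)$. A perfect lattice path in $T_{m,n}$ is a sequence of rows $(r_1,\dots,r_n)$ with $r_i\in\{1,\dots,m\}$ and $|r_{i+1}-r_i|\le1$ (a path from the first column to the last column staying in the table); $\mathcal{I}_m(n)$ is the number of them. For $1\le s\le k$ and $1\le t\le k$, $\mathcal{D}_k(s,t)$ denotes the number of sequences $(r_1,\dots,r_s)$ with $r_i\in\{1,\dots,k\}$, $|r_{i+1}-r_i|\le1$ and $r_s=t$, i.e. the number of such paths inside the square $k\times k$ table from any cell of the first column to the $(s,t)$-cell. *)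

(* Defs.v *)
From mathcomp Require Import all_boot all_order all_algebra.

Set Implicit Arguments.
Unset Strict Implicit.
Unset Printing Implicit Defensive.

Import IntDist.

(* Consecutive rows of a path with steps (1,0), (1,1), (1,-1). *)
Definition row_step : rel nat := fun a b => `|b - a|%N <= 1.

(* A path over n columns of a table with m rows is an n.-tuple over 'I_m;
   i : 'I_m stands for row i.+1, so rows are numbered 1, ..., m. *)
Definition rows (m n : nat) (r : n.-tuple 'I_m) : seq nat :=
  [seq (i : 'I_m).+1 | i <- r].

Definition lattice_path (m n : nat) (r : n.-tuple 'I_m) : bool :=
  sorted row_step (rows r).

Definition num_perfect_paths (m n : nat) : nat :=
  #|[set r : n.-tuple 'I_m | lattice_path r]|.

(* D_k(s,t); meant for 1 <= s <= k and 1 <= t <= k. The default 0 of last is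
   not a row number: it is only reached for s = 0. *)
Definition num_paths_to (k s t : nat) : nat :=
  #|[set r : s.-tuple 'I_k | lattice_path r & last 0 (rows r) == t]|.

(* Main.v *)
Require Import Defs.
From mathcomp Require Import all_boot all_order all_algebra zify.

(** Write [D_m(s, t)] for the number of paths with [s] columns ending in row
    [t]. Extending a path of the table with [m] rows by one column gives
    [I_m(s+1) = 3 I_m(s) - D_m(s, 1) - D_m(s, m)], and the last two terms agree
    by symmetry. It remains to see that [I_(m+1)(m+1) - I_m(m+1) = 3^m], that
    is, that [3^m] paths with [m+1] columns touch the top row. Let [V s j] count
    the paths with [s] steps that stay in the rows [1, 2, ...] and end in row
    [j]; it equals [3^s] for [j > s]. A path with at most [m] steps that touches
    the top row [m+1] is never stopped by the bottom of the table, so those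
    ending in row [t] number [V s (m+2-t) - V s (m+1-t)], and the sum over [t]
    telescopes to [V s (m+1) = 3^s]. *)

(** Serves to peel off the last column of a path. *)
Lemma sum_tuple_rcons (T : finType) (s : nat) (F : seq T -> nat) :
  \sum_(r : s.+1.-tuple T) F r
    = \sum_(r : s.-tuple T) \sum_(x : T) F (rcons r x).
Proof.
rewrite pair_big /=.
rewrite (reindex (fun p : s.-tuple T * T => [tuple of rcons p.1 p.2])) //=.
exists (fun r : s.+1.-tuple T =>
  ([tuple of belast (thead r) (behead r)], last (thead r) (behead r))).
  move=> [r x] _ /=; congr (_, _); last first.
    rewrite /thead (tnth_nth x) /=.
    by case: r => -[|a r] //= _; rewrite last_rcons.
  apply: val_inj; rewrite /= /thead (tnth_nth x) /=.
  by case: r => -[|a r] //= _; rewrite belast_rcons.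
move=> r _; apply: val_inj; rewrite /= -lastI.
by case/tupleP: r => a r; rewrite theadE.
Qed.

Lemma sorted_rcons_last (e : rel nat) (l : seq nat) (x : nat) :
  0 < size l -> sorted e (rcons l x) = sorted e l && e (last 0 l) x.
Proof. by case: l => //= a l _; rewrite rcons_path. Qed.

Definition rows_of {m : nat} (r : seq 'I_m) : seq nat :=
  [seq (i : 'I_m).+1 | i <- r].

Lemma num_paths_toE m s t :
  num_paths_to m s t = \sum_(r : s.-tuple 'I_m)
    (sorted row_step (rows_of r) && (last 0 (rows_of r) == t)).
Proof.
rewrite /num_paths_to -sum1_card big_mkcond /=; apply: eq_bigr => r _.
rewrite inE -[lattice_path r]/(sorted row_step (rows_of r)).
by case: sorted => //=; case: eqP.
Qed.

Lemma num_perfect_pathsE m s :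
  num_perfect_paths m s = \sum_(r : s.-tuple 'I_m) sorted row_step (rows_of r).
Proof.
rewrite /num_perfect_paths -sum1_card big_mkcond /=; apply: eq_bigr => r _.
rewrite inE -[lattice_path r]/(sorted row_step (rows_of r)).
by case: sorted.
Qed.

Lemma sum_ord_eq m t : \sum_(x < m) (x.+1 == t) = (0 < t <= m).
Proof.
case: t => [|t] /=; first by rewrite big1.
case: (ltnP t m) => h.
  by rewrite (bigD1 (Ordinal h)) //= eqxx big1 // => i; rewrite -val_eqE /= eqSS => /negbTE ->.
by rewrite big1 // => i _; rewrite eqSS; have := ltn_ord i; lia.
Qed.

Lemma num_paths_to1 m t : num_paths_to m 1 t = (0 < t <= m).
Proof.
rewrite num_paths_toE
  (@sum_tuple_rcons _ 0 (fun r => sorted row_step (rows_of r) && (last 0 (rows_of r) == t) : nat)).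
rewrite (eq_bigr (fun=> (0 < t <= m) : nat)) => [|r _].
  by rewrite sum_nat_const card_tuple expn0 mul1n.
by rewrite tuple0 /= sum_ord_eq.
Qed.

(** Recursion on the last step. It starts from one column, since on the empty path the default of
    [last] would count as row 0. *)
Lemma num_paths_toS m s t :
  num_paths_to m s.+2 t = (0 < t <= m) *
    (num_paths_to m s.+1 t.-1 + num_paths_to m s.+1 t + num_paths_to m s.+1 t.+1).
Proof.
rewrite num_paths_toE
  (@sum_tuple_rcons _ s.+1 (fun r => sorted row_step (rows_of r) && (last 0 (rows_of r) == t) : nat)).
rewrite !num_paths_toE -!big_split big_distrr /=; apply: eq_bigr => r _.
rewrite -sum_ord_eq big_distrl /=; apply: eq_bigr => x _.
rewrite /rows_of map_rcons sorted_rcons_last ?size_map ?size_tuple // last_rcons.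
case: sorted => //=; last by rewrite muln0.
case: eqP => [<-|_]; last by rewrite andbF.
rewrite andbT mul1n /row_step /=; set a := last _ _; lia.
Qed.

Lemma num_paths_to_out m s t : ~~ (0 < t <= m) -> num_paths_to m s.+1 t = 0.
Proof.
by case: s => [|s] /negbTE h; rewrite ?num_paths_to1 ?num_paths_toS h.
Qed.

Lemma num_perfect_paths_sum m s :
  num_perfect_paths m s.+1 = \sum_(1 <= t < m.+1) num_paths_to m s.+1 t.
Proof.
rewrite num_perfect_pathsE big_add1 /= big_mkord.
under [RHS]eq_bigr => t _ do rewrite num_paths_toE.
rewrite exchange_big /=; apply: eq_bigr => r _.
case: sorted => /=; last by rewrite big1.
under eq_bigr => t _ do rewrite eq_sym.
rewrite sum_ord_eq /rows_of (tuple_eta r) /= last_map.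
by rewrite ltn_ord.
Qed.

(** Turning the table upside down preserves steps. Rows 0 and [m.+1] are included so that the
    induction covers the neighbours of rows 1 and [m]. *)
Lemma num_paths_to_sym m s t : t <= m.+1 ->
  num_paths_to m s.+1 (m.+1 - t) = num_paths_to m s.+1 t.
Proof.
elim: s t => [|s IH] t h; first by rewrite !num_paths_to1; lia.
rewrite !num_paths_toS.
have -> : (0 < m.+1 - t <= m) = (0 < t <= m) by lia.
case: (boolP (0 < t <= m)) => // ht; rewrite !mul1n.
have -> : (m.+1 - t).-1 = m.+1 - t.+1 by lia.
have -> : (m.+1 - t).+1 = m.+1 - t.-1 by lia.
by rewrite !IH; lia.
Qed.

Lemma num_perfect_pathsS m s :
  num_perfect_paths m.+1 s.+2 + 2 * num_paths_to m.+1 s.+1 m.+1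
    = 3 * num_perfect_paths m.+1 s.+1.
Proof.
rewrite !num_perfect_paths_sum.
set f := num_paths_to m.+1 s.+1.
have f0 : f 0 = 0 by rewrite /f num_paths_to_out.
have fm : f m.+2 = 0 by rewrite /f num_paths_to_out //; lia.
have f1 : f 1 = f m.+1 by rewrite /f -num_paths_to_sym // subn1.
have -> : \sum_(1 <= t < m.+2) num_paths_to m.+1 s.+2 t
    = \sum_(1 <= t < m.+2) (f t.-1 + f t + f t.+1).
  by apply: eq_big_nat => t ht; rewrite num_paths_toS ht mul1n.
rewrite !big_split /=.
have -> : \sum_(1 <= t < m.+2) f t.-1 = \sum_(1 <= t < m.+1) f t.
  by rewrite big_add1 /= big_nat_recl // f0 add0n [RHS]big_add1.
have -> : \sum_(1 <= t < m.+2) f t.+1 = \sum_(2 <= t < m.+2) f t.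
  by rewrite [RHS]big_add1 /= big_nat_recr //= fm addn0.
have e1 : \sum_(1 <= t < m.+2) f t = \sum_(1 <= t < m.+1) f t + f m.+1.
  by rewrite big_nat_recr.
have e2 : \sum_(1 <= t < m.+2) f t = f 1 + \sum_(2 <= t < m.+2) f t.
  by rewrite big_ltn.
lia.
Qed.

(** The start row is free, whence the base value 1; row 0 acts as a wall. *)
Fixpoint half_plane_paths (s j : nat) {struct s} : nat :=
  if j is j'.+1 then
    if s is s'.+1 then half_plane_paths s' j' + half_plane_paths s' j
                       + half_plane_paths s' j.+1
    else 1
  else 0.

Local Notation V := half_plane_paths.

Lemma half_plane_paths0 s : V s 0 = 0.
Proof. by case: s. Qed.

Lemma half_plane_paths_no_step j : V 0 j = (0 < j).
Proof. by case: j. Qed.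

Lemma half_plane_pathsS s j : V s.+1 j.+1 = V s j + V s j.+1 + V s j.+2.
Proof. by []. Qed.

(** Traced back from row [j], [s] steps cannot reach row 0, so every choice of steps is allowed. *)
Lemma half_plane_paths_far s j : s < j -> V s j = 3 ^ s.
Proof.
elim: s j => [|s IH] [|j] // h; rewrite half_plane_pathsS !IH ?expnS; lia.
Qed.

(** Traced back from row [t], the path cannot leave through the bottom; only the top constrains it,
    and a flip makes row [m] row 1. *)
Lemma num_paths_to_far m s t : s < t -> num_paths_to m s.+1 t = V s (m.+1 - t).
Proof.
elim: s t => [|s IH] t h.
  by rewrite num_paths_to1 half_plane_paths_no_step; lia.
rewrite num_paths_toS; case: (ltnP m t) => hm.
  have -> : m.+1 - t = 0 by lia.
  by rewrite andbF mul0n.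
have -> : m.+1 - t = (m - t).+1 by lia.
rewrite half_plane_pathsS !IH; try lia.
have -> : m.+1 - t.-1 = (m - t).+2 by lia.
have -> : m.+1 - t = (m - t).+1 by lia.
have -> : m.+1 - t.+1 = m - t by lia.
lia.
Qed.

Lemma num_paths_to_touching_top m s t : s <= m ->
  num_paths_to m.+1 s.+1 t + V s (m.+1 - t)
    = num_paths_to m s.+1 t + V s (m.+2 - t).
Proof.
elim: s t => [|s IH] t h.
  by rewrite !num_paths_to1 !half_plane_paths_no_step; lia.
case: t => [|t].
  by rewrite !num_paths_to_out // !half_plane_paths_far; lia.
have sm : s <= m by lia.
have := (IH t sm, IH t.+1 sm, IH t.+2 sm).
rewrite !num_paths_toS [t.+1.-1]/=; case: (ltngtP t m) => hm.
- have [k ek] : exists k, m = t + k.+1 by exists (m - t).-1; lia.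
  have [-> -> -> ->] : [/\ m.+1 - t = k.+2, m.+1 - t.+1 = k.+1, m.+1 - t.+2 = k
    & m.+2 - t = k.+3] by split; lia.
  have [-> ->] : m.+2 - t.+1 = k.+2 /\ m.+2 - t.+2 = k.+1 by lia.
  rewrite !half_plane_pathsS => -[[]]; lia.
- have [-> ->] : m.+1 - t.+1 = 0 /\ m.+2 - t.+1 = 0 by lia.
  by have -> : (t < m.+1) = false by lia.
(* In the top row of the larger table [V s.+1 0] does not unfold into three terms, so the induction
   hypotheses alone do not suffice; [num_paths_to_far] supplies the value at row [m]. *)
- rewrite hm in sm *.
  have [-> -> -> ->] : [/\ m.+1 - m = 1, m.+1 - m.+1 = 0, m.+1 - m.+2 = 0
    & m.+2 - m = 2] by split; lia.
  have [-> ->] : m.+2 - m.+1 = 1 /\ m.+2 - m.+2 = 0 by lia.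
  rewrite half_plane_pathsS !half_plane_paths0.
  have := @num_paths_to_far m s m h; rewrite subSnn => ->.
  have -> : num_paths_to m s.+1 m.+1 = 0 by rewrite num_paths_to_out //; lia.
  have -> : num_paths_to m.+1 s.+1 m.+2 = 0 by rewrite num_paths_to_out //; lia.
  move=> [[]]; lia.
Qed.

Lemma num_perfect_paths_add_row m s : s <= m ->
  num_perfect_paths m.+1 s.+1 = num_perfect_paths m s.+1 + 3 ^ s.
Proof.
move=> h; rewrite !num_perfect_paths_sum.
have tele k : \sum_(1 <= t < k.+1) num_paths_to m.+1 s.+1 t + V s (m.+1 - k)
    = \sum_(1 <= t < k.+1) num_paths_to m s.+1 t + V s m.+1.
  elim: k => [|k IHk]; first by rewrite !big_geq // subn0.
  rewrite !(big_nat_recr k.+1) //=.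
  have := @num_paths_to_touching_top m s k.+1 h; rewrite (subSS k m.+1); lia.
have := tele m.+1.
rewrite subnn half_plane_paths0 half_plane_paths_far // addn0 => ->.
(* Row [m.+1] lies outside the smaller table, so its term vanishes. *)
by rewrite big_nat_recr //= [X in _ + X + _]num_paths_to_out ?addn0 //; lia.
Qed.

Local Open Scope ring_scope.

(* The identity is stated in int, so that the subtraction is not truncated. *)
Theorem theorem2p1 (n : nat) (hn : (2 <= n)%N) :
  (num_perfect_paths n n)%:Z =
    3 * (num_perfect_paths (n - 1) (n - 1))%:Z + 3 ^+ (n - 1)
    - 2 * (num_paths_to (n - 1) (n - 1) (n - 1))%:Z :> int.
Proof.
case: n hn => [|[|m]] // _; rewrite subn1 /=.
(* With [n = m.+2], the top row is removed first, then the last column. *)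
rewrite num_perfect_paths_add_row //.
have e := num_perfect_pathsS m m.
have -> : 3 ^+ m.+1 = (3 ^ m.+1)%N%:Z :> int by rewrite -natz GRing.natrX.
lia.
Qed.
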